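(* Let $(X,d)$ be a semi-metric space and let $(Y,\|\cdot\|)$ be a Banach space. Assume that $T,S:X\to Y$ are two mappings satisfying: (C1) $T(X)$ is a closed convex subset of $Y$; (C2) $S(X)\subseteq T(X)$ and $\|S(x)-S(y)\|\le\|T(x)-T(y)\|$ for all $x,y\in X$; (C3) there exists $f\in\mathcal{F}$ such that $f(\|T(x)-T(y)\|)\le d(x,y)$ for all $x,y\in X$; (C4) $T-S$ is $\varphi$-expansive; (C5) there exist $x_0\in X$ and $R>0$ such that, for every $x\in X$ with $\|T(x)-T(x_0)\|\ge R$, one has $S(x)-T(x_0)\ne\lambda\,(T(x)-T(x_0))$ for all $\lambda>1$. Then there exists a unique $x\in X$ such that $T(x)=S(x)$.
   Context: A semi-metric on a nonempty set $X$ is a function $d:X\times X\to\mathbb{R}_+$ (with $\mathbb{R}_+=[0,\infty)$) such that $d(x,y)=0$ if and only if $x=y$, and $d(x,y)=d(y,x)$ for all $x,y\in X$ (no triangle inequality is required); $(X,d)$ is then a semi-metric space. $\mathcal{F}$ is the family of all functions $f:\mathbb{R}_+\to\mathbb{R}_+$ such that $f(r)=0$ if and only if $r=0$, and $f$ is nondecreasing. A mapping $A:X\to Y$ from a semi-metric space $(X,d)$ to a normed space $Y$ is $\varphi$-expansive if there exists a function $\varphi\in\mathcal{F}$ such that $\|Ax-Ay\|\ge\varphi(d(x,y))$ for all $x,y\in X$. *)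

(* Defs.v *)
From HB Require Import structures.
From mathcomp Require Export all_boot all_order all_algebra.
From mathcomp Require Export all_classical all_reals all_analysis.
Export Order.TTheory GRing.Theory Num.Theory.
Export numFieldNormedType.Exports.

Set Implicit Arguments.
Unset Strict Implicit.
Unset Printing Implicit Defensive.

Local Open Scope classical_set_scope.
Local Open Scope ring_scope.

(* The half-line [0, +oo[ is rendered by the type {nonneg R}; r%:num is the
   underlying element of R. *)

(* No triangle inequality is required. *)
Definition semi_metric (R : realType) (X : Type) (d : X -> X -> {nonneg R}) :
    Prop :=
  [/\ inhabited X,
      forall x y : X, (d x y)%:num = 0 <-> x = y
    & forall x y : X, d x y = d y x].

Definition classF (R : realType) : set ({nonneg R} -> {nonneg R}) :=
  [set f | (forall r : {nonneg R}, (f r)%:num = 0 <-> r%:num = 0) /\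
           {homo f : r s / r%:num <= s%:num}].

Definition phi_expansive (R : realType) (X : Type) (d : X -> X -> {nonneg R})
    (Y : normedModType R) (A : X -> Y) : Prop :=
  exists2 phi : {nonneg R} -> {nonneg R}, classF phi
    & forall x y : X, (phi (d x y))%:num <= `|A x - A y|.

(* Main.v *)
From HB Require Import structures.
From mathcomp Require Import lra.
Require Import Defs.

(** Since [S x] depends only on [T x], setting [g (T x) = S x] turns the
    coincidence problem into a fixed point problem for a nonexpansive self-map
    [g] of the closed convex set [K = range T].  Nonexpansive maps need not have
    fixed points in a general Banach space; two features of [g] rescue
    existence.

    The displacement [u - g u] separates points uniformly: by (C3), (C4) and
    monotonicity, points of [K] at distance at least [e] have displacements at
    distance at least [phi (f e) > 0].  Hence any sequence along which the
    displacement tends to [0] is Cauchy, and its limit is a fixed point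
    ([vanishing_displacement_fixpoint]).

    Such a sequence comes from damping [g] towards [z = T x0]: for [0 < t < 1]
    the map [u |-> t g u + (1 - t) z] is a contraction of [K], with a fixed
    point [u_t] ([damped_fixpoint]).  At [u_t] one has
    [g u_t - z = t^-1 (u_t - z)] with [t^-1 > 1], so the boundary condition (C5)
    keeps [u_t] within distance [r] of [z], and the displacement of [u_t] has
    norm at most [(t^-1 - 1) r], which vanishes as [t] tends to [1].

    Uniqueness is the injectivity of [T - S], immediate from (C4). *)

Set Implicit Arguments.
Unset Strict Implicit.
Unset Printing Implicit Defensive.

Local Open Scope classical_set_scope.
Local Open Scope ring_scope.

Lemma convex_set_comb (R : realType) (Y : normedModType R) (K : set Y)
    (t : R) (a b : Y) :
  convex_set K -> K a -> K b -> 0 <= t <= 1 -> K (t *: a + (1 - t) *: b).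
Proof.
move=> convK Ka Kb /andP[t0 t1].
have /set_mem := convK a b (Itv01 t0 t1) (mem_set Ka) (mem_set Kb).
exact.
Qed.

(** Damping a nonexpansive map towards a point [z] of its domain makes it a
    contraction, whose fixed point lies on the segment from [z] to its image. *)
Lemma damped_fixpoint (R : realType) (Y : completeNormedModType R) (K : set Y)
    (g : Y -> Y) (z : Y) (t : R) :
  closed K -> convex_set K -> K z ->
  (forall u, K u -> K (g u)) ->
  (forall u v, K u -> K v -> `|g u - g v| <= `|u - v|) ->
  0 <= t < 1 -> exists2 u, K u & u - z = t *: (g u - z).
Proof.
move=> clK convK Kz gK gne /andP[t0 t1].
pose h u := t *: g u + (1 - t) *: z.
have hK : set_fun K K h.
  by move=> u Ku; apply: convex_set_comb => //; [exact: gK|rewrite t0 ltW].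
pose H : {fun K >-> K} := HB.pack h (isFun.Build _ _ K K h hK).
have ctrH : is_contraction H.
  exists (NngNum t0); split => //= -[u v] [/= Ku Kv].
  rewrite /h opprD addrACA subrr addr0 -scalerBr normrZ ger0_norm//.
  by rewrite ler_wpM2l// gne.
have [u Ku uE] := banach_fixed_point ctrH clK (ex_intro _ z Kz).
exists u => //; rewrite {1}uE /= /h scalerBr scalerBl scale1r.
by rewrite addrA addrAC addrK.
Qed.

(** The displacement hypothesis says that [u - g u] determines [u] with a
    uniformly continuous inverse, so small displacements force the sequence
    to be Cauchy. *)
Lemma vanishing_displacement_fixpoint (R : realType)
    (Y : completeNormedModType R) (K : set Y) (g : Y -> Y) (u : Y^nat) :
  closed K ->
  (forall u v, K u -> K v -> `|g u - g v| <= `|u - v|) ->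
  (forall e : R, 0 < e -> exists2 del : R, 0 < del &
    forall u v, K u -> K v -> e <= `|u - v| ->
      del <= `|(u - g u) - (v - g v)|) ->
  (forall n, K (u n)) ->
  (fun n => u n - g (u n)) @ \oo --> (0 : Y) ->
  exists2 l, K l & l = g l.
Proof.
move=> clK gne sep uK /cvgr0Pnorm_lt disp0.
have cvu : cvgn u.
  apply/cauchy_cvgP/cauchy_ballP => e e0; rewrite !near_map2 -ball_normE.
  have [del del0 sepe] := sep e e0.
  (* Two displacements below [del / 2] are closer than [del]. *)
  have del2 : 0 < del / 2 by rewrite divr_gt0.
  have small := disp0 _ del2.
  near=> n m => /=; rewrite ltNge; apply/negP => /(sepe _ _ (uK n) (uK m)).
  apply/negP; rewrite -ltNge (le_lt_trans (ler_normB _ _))//.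
  by rewrite (splitr del) ltrD//; [near: n|near: m].
have Kl : K (limn u) by apply: closed_cvg cvu => //; exact: nearW.
exists (limn u) => //; apply/eqP; rewrite -subr_eq0 -normr_le0.
apply/ler_addgt0Pr => e e0; rewrite add0r.
have e3 : 0 < e / 3 by rewrite divr_gt0.
have small := disp0 _ e3.
have /cvgrPdist_lt/(_ _ e3) near_lim := cvu.
near \oo => n.
have d1 : `|limn u - u n| < e / 3 by near: n.
have d2 : `|u n - g (u n)| < e / 3 by near: n.
have d3 : `|g (u n) - g (limn u)| < e / 3.
  by apply: le_lt_trans d1; rewrite distrC; exact: gne.
rewrite (le_trans (ler_distD (u n) _ _))//.
have := ler_distD (g (u n)) (u n) (g (limn u)).
by lra.
Unshelve. all: by end_near. Qed.

(** Damped fixed points supply points of arbitrarily small displacement, since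
    the boundary condition at [z] confines all of them to one ball. *)
Lemma leray_schauder_fixpoint (R : realType) (Y : completeNormedModType R)
    (K : set Y) (g : Y -> Y) (z : Y) (r : R) :
  closed K -> convex_set K -> K z ->
  (forall u, K u -> K (g u)) ->
  (forall u v, K u -> K v -> `|g u - g v| <= `|u - v|) ->
  (forall e : R, 0 < e -> exists2 del : R, 0 < del &
    forall u v, K u -> K v -> e <= `|u - v| ->
      del <= `|(u - g u) - (v - g v)|) ->
  (forall u, K u -> r <= `|u - z| ->
    forall lambda : R, 1 < lambda -> g u - z <> lambda *: (u - z)) ->
  exists2 u, K u & u = g u.
Proof.
move=> clK convK Kz gK gne sep bnd.
have approx n : exists u, K u /\ `|u - g u| <= r * harmonic n.
  (* The factor is chosen so that [lambda - 1 = harmonic n]. *)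
  pose lambda : R := 1 + harmonic n.
  have hn : 0 < harmonic n :> R by exact: harmonic_gt0.
  have lam1 : 1 < lambda by rewrite ltrDl.
  have lam0 : 0 < lambda by exact: lt_trans lam1.
  have [|u Ku uE] := @damped_fixpoint _ _ K g z lambda^-1 clK convK Kz gK gne.
    by rewrite invr_ge0 ltW//= invf_lt1.
  have guE : g u - z = lambda *: (u - z).
    by rewrite uE scalerA mulfV ?gt_eqF// scale1r.
  exists u; split=> //.
  have -> : u - g u = - (harmonic n *: (u - z)).
    rewrite -(subrKA z u) -[z - g u]opprB guE /lambda scalerDl scale1r opprD.
    by rewrite addrA subrr add0r.
  rewrite normrN normrZ (gtr0_norm hn) mulrC ler_pM2r//.
  by rewrite ltW// ltNge; apply/negP => /(bnd u Ku)/(_ _ lam1)/(_ guE).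
have [u uP] := choice approx.
apply: (@vanishing_displacement_fixpoint _ _ K g u) => // [n|].
  by have [] := uP n.
have bound0 : (fun n => r * harmonic n) @ \oo --> (0 : R).
  by rewrite -[X in _ --> X](mulr0 r); apply: cvgMl_tmp; exact: cvg_harmonic.
apply: norm_cvg0; apply: squeeze_cvgr (cvg_cst 0) bound0.
by apply: nearW => n; rewrite normr_ge0; have [] := uP n.
Qed.

Lemma classF_gt0 (R : realType) (f : {nonneg R} -> {nonneg R})
    (r : {nonneg R}) :
  classF f -> 0 < r%:num -> 0 < (f r)%:num.
Proof.
move=> [f0 _] r0; rewrite lt_def ge0 andbT; apply/eqP => /f0 rE.
by rewrite rE ltxx in r0.
Qed.

Theorem theorem4p1 (R : realType) (X : Type) (d : X -> X -> {nonneg R})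
    (Y : completeNormedModType R) (T S : X -> Y)
    (d_semi_metric : semi_metric d)
    (C1 : closed (range T) /\ convex_set (range T))
    (C2 : range S `<=` range T /\
          forall x y : X, `|S x - S y| <= `|T x - T y|)
    (C3 : exists2 f : {nonneg R} -> {nonneg R}, classF f
            & forall x y : X, (f `|T x - T y|%:nng)%:num <= (d x y)%:num)
    (C4 : phi_expansive d (T \- S))
    (C5 : exists (x0 : X) (r : R), 0 < r /\
            forall x : X, r <= `|T x - T x0| ->
            forall lambda : R, 1 < lambda ->
              S x - T x0 <> lambda *: (T x - T x0)) :
  exists! x : X, T x = S x.
Proof.
have [_ dE _] := d_semi_metric.
have [clK convK] := C1.
have [SK Sne] := C2.
have [f Ff fd] := C3.
have [phi Fphi phid] := C4.
have [x0 [r [_ bnd]]] := C5.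
have factor u : exists v, forall x, T x = u -> S x = v.
  have [[x _ xu]|nu] := pselect (range T u).
    exists (S x) => y yu; apply/eqP; rewrite -subr_eq0 -normr_le0.
    by rewrite (le_trans (Sne _ _))// yu xu subrr normr0.
  (* Off [range T] the value is arbitrary, as [g] is only used on [range T]. *)
  by exists 0 => x xu; exfalso; apply: nu; exists x.
have [g gT] := choice factor.
have {}gT x : g (T x) = S x by exact/esym/gT.
have [u [x _ <-] fixx] : exists2 u, range T u & u = g u.
  apply: (@leray_schauder_fixpoint _ _ (range T) g (T x0) r) => //.
  - by move=> _ [x _ <-]; rewrite gT; apply: SK; exists x.
  - by move=> _ _ [x _ <-] [y _ <-]; rewrite !gT.
  - move=> e e0; pose e' := NngNum (ltW e0).
    exists (phi (f e'))%:num; first by do 2 apply: classF_gt0 => //.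
    move=> _ _ [x _ <-] [y _ <-] exy; rewrite !gT.
    apply: le_trans (phid x y); apply: Fphi.2; apply: le_trans (fd x y).
    exact: Ff.2.
  - by move=> _ [x _ <-] rx lambda lam1; rewrite gT; exact: bnd.
rewrite gT in fixx; exists x; split=> // y fixy; apply/dE/Fphi.1/le_anti.
by rewrite ge0 andbT (le_trans (phid x y))//= fixx fixy !subrr normr0.
Qed.
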